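(* For all strictly positive rationals $U,b$, all integers $T\ge1$, and all $\mu\in[0,U]_{\mathcal Q}$, $\mathrm{Opt}^T_{\mathbf{GEN}}(\mu,U,b)=\mathrm{Opt}^T_{\mathbf{IND}}(\mu,U,b)$.
   Context: $[0,U]_{\mathcal Q}=[0,U]\cap\mathbb Q$; $z_+=\max(z,0)$; $C(x,d)=b(d-x)_++(x-d)_+$. For a vector $\mathbf d$, $\mathbf d_{[s]}=(d_1,\dots,d_s)$ ($\mathbf d_{[0]}$ is empty). With initial inventory $x_0$, an admissible policy $\pi$ is a vector $(x^\pi_1,\dots,x^\pi_T)$ where $x_1^\pi$ is a rational constant with $x_1^\pi\ge x_0$, and for $2\le t\le T$, $x^\pi_t:[0,U]_{\mathcal Q}^{t-1}\to\mathbb Q$ satisfies $x^\pi_{t}(\mathbf d)\ge x^\pi_{t-1}(\mathbf d_{[t-2]})-d_{t-1}$ for all $\mathbf d\in[0,U]_{\mathcal Q}^{t-1}$. $\Pi$ is the set of admissible policies with all values $x^\pi_t(\cdot)\in[0,U]$. The cost in period $t$ is $C^\pi_t=C(x^\pi_t(D_{[t-1]}),D_t)$, where $D=(D_1,\dots,D_T)$ is the demand vector. $\mathfrak M(\mu)$ is the set of probability measures on $[0,U]_{\mathcal Q}$ with mean $\mu$. $\mathbf{GEN}_T$ is the set of all probability measures $Q$ on $[0,U]_{\mathcal Q}^T$ all of whose one-dimensional marginals lie in $\mathfrak M(\mu)$, and $$\mathrm{Opt}^T_{\mathbf{GEN}}(\mu,U,b)=\inf_{\pi\in\Pi}\sup_{Q\in\mathbf{GEN}_T}\mathbb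 E_Q\Big[\sum_{t=1}^TC^\pi_t\Big]\quad\text{with }x_0=0.$$ $\mathrm{Opt}^T_{\mathbf{IND}}(\mu,U,b)=Tb\mu$ if $\mu\le\frac{U}{b+1}$ and $=T(U-\mu)$ if $\mu>\frac{U}{b+1}$. (This is known to be the value, with $x_0=0$, of the analogous inf-sup in which $Q$ ranges only over product measures with all marginals in $\mathfrak M(\mu)$.) *)

(* Defs.v *)
From HB Require Import structures.
From mathcomp Require Import all_boot all_order all_algebra.
From mathcomp Require Import all_classical all_reals all_analysis.

Set Implicit Arguments.
Unset Strict Implicit.
Unset Printing Implicit Defensive.

Import Order.TTheory GRing.Theory Num.Theory.
Import numFieldNormedType.Exports.

Local Open Scope classical_set_scope.
Local Open Scope ring_scope.

(* The rational interval [0, U].  Being countable, it carries the discrete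
   sigma-algebra; U is bundled with its positivity because measurable types
   must be inhabited. *)
Definition ratIcc (U : {posnum rat}) : Type := {x : rat | 0 <= x <= U%:num}.

HB.instance Definition _ (U : {posnum rat}) := SubCountable.on (ratIcc U).

Lemma ratIcc0_subproof (U : {posnum rat}) : 0 <= (0 : rat) <= U%:num.
Proof. by rewrite lexx ltW. Qed.

HB.instance Definition _ (U : {posnum rat}) :=
  isPointed.Build (ratIcc U) (exist _ 0 (ratIcc0_subproof U)).

HB.instance Definition _ (U : {posnum rat}) :=
  @isMeasurable.Build default_measure_display (ratIcc U)
    discrete_measurable discrete_measurable0
    discrete_measurableC discrete_measurableU.

Definition demand_at (U : {posnum rat}) (n : nat) (i : 'I_n)
  (d : n.-tuple (ratIcc U)) : ratIcc U := tnth d i.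

HB.instance Definition _ (U : {posnum rat}) (n : nat) (i : 'I_n) :=
  isMeasurableFun.Build _ _ _ _ (@demand_at U n i) (measurable_tnth i).

Definition cost (b x d : rat) : rat :=
  b * Num.max (d - x) 0 + Num.max (x - d) 0.

Definition history (A : Type) (s n : nat) (le_sn : (s <= n)%N) (d : n.-tuple A) :
  s.-tuple A := [tuple tnth d (widen_ord le_sn i) | i < s].

(* Periods are numbered from 0: [x t] is the decision of the (t+1)-st period,
   a function of the first t demands. *)
Definition policy (U : {posnum rat}) (T : nat) : Type :=
  forall t : 'I_T, t.-tuple (ratIcc U) -> rat.

Definition admissible (U : {posnum rat}) (T : nat) (x0 : rat)
    (x : policy U T) : Prop :=
  (forall (t : 'I_T) (d : t.-tuple (ratIcc U)), t = 0%N :> nat -> x0 <= x t d) /\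
  (forall (s t : 'I_T) (lt_st : (s < t)%N) (d : t.-tuple (ratIcc U)),
     t = s.+1 :> nat ->
     x s (history (ltnW lt_st) d) - val (tnth d (Ordinal lt_st)) <= x t d).

Definition Policies (U : {posnum rat}) (T : nat) (x0 : rat) :
    set (policy U T) :=
  [set x | admissible x0 x /\
           forall (t : 'I_T) (d : t.-tuple (ratIcc U)), 0 <= x t d <= U%:num].

Definition period_cost (U : {posnum rat}) (T : nat) (b : rat) (x : policy U T)
    (t : 'I_T) (d : T.-tuple (ratIcc U)) : rat :=
  cost b (x t (history (ltnW (ltn_ord t)) d)) (val (tnth d t)).

Definition mean_measures (R : realType) (U : {posnum rat}) (mu : rat) :
    set (probability (ratIcc U) R) :=
  [set P : probability (ratIcc U) R |
     ('E_P[fun x : ratIcc U => ratr (val x)] = (ratr mu)%:E)%E].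

Definition GEN (R : realType) (U : {posnum rat}) (T : nat) (mu : rat) :
    set (probability (T.-tuple (ratIcc U)) R) :=
  [set Q : probability (T.-tuple (ratIcc U)) R |
     forall t : 'I_T, mean_measures mu (distribution Q (@demand_at U T t))].

Definition Opt_GEN (R : realType) (T : nat) (mu : rat) (U : {posnum rat})
    (b : rat) : \bar R :=
  ereal_inf
    [set ereal_sup
       [set ('E_Q[fun d => ratr (\sum_(t < T) period_cost b x t d)%R])%E
         | Q in @GEN R U T mu]
      | x in @Policies U T 0].

(* Closed form of the optimal value when the demands are independent. *)
Definition Opt_IND (T : nat) (mu : rat) (U : {posnum rat}) (b : rat) : rat :=
  if mu <= U%:num / (b + 1) then T%:R * b * mu else T%:R * (U%:num - mu).

(* Main.v *)
From HB Require Import structures.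
Require Import Defs.
From mathcomp Require Import all_boot all_order all_algebra.
From mathcomp Require Import all_classical all_reals all_analysis.
From mathcomp Require Import measurable_realfun ring lra.

Set Implicit Arguments.
Unset Strict Implicit.
Unset Printing Implicit Defensive.

Import Order.TTheory GRing.Theory Num.Theory.

Local Open Scope classical_set_scope.
Local Open Scope ring_scope.

(** Dependence between periods gives the adversary no extra power, because a
constant policy already makes the expected cost insensitive to it, while a
product measure already forces that cost.

Upper bound ([optimal_policy]).  Always stocking [0] costs [b d] for a demand
[d], and always stocking [U] costs [U - d].  Both costs are affine in the
demand, so their expectation under any measure with marginal means [mu] is
[b mu], respectively [U - mu], per period: only the marginals matter.  The
threshold [U / (b + 1)] tells which of the two numbers is smaller.

Lower bound ([sup_cost_ge]).  Let the demands be independent, equal to [U] with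
probability [p = mu / U] and to [0] otherwise; their mean is [mu].  The stock
[x] of a period depends on earlier demands only, so given those demands the
expected cost of the period is
[p b (U - x) + (1 - p) x = b mu + (x / U) (U - (b + 1) mu)].
This is affine in [x], hence on [[0, U]] at least the smaller of its values
[b mu] at [x = 0] and [U - mu] at [x = U] ([two_point_cost]).

The product measure is realized as a finite mixture of Dirac masses at the
[2 ^ T] paths of extreme demands ([finite_mixture], [extreme_measure]).
Conditioning on all coins but one amounts to pairing each toss with the toss
whose [t]-th coin is flipped ([toss_sum_split]): the flip does not alter the
history before [t], hence not the stock either ([history_flip]). *)

(** * Finite mixtures of Dirac masses *)

Lemma finite_mixture (R : realType) (d : measure_display) (X : measurableType d)
    (I : finType) (w : I -> R) (x : I -> X) :
  (forall i, 0 <= w i) -> \sum_i w i = 1 ->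
  exists Q : probability X R, forall g : X -> \bar R,
    measurable_fun [set: X] g -> (forall y, 0 <= g y)%E ->
    (\int[Q]_y g y = \sum_i (w i)%:E * g (x i))%E.
Proof.
move=> w0 w1.
(* Weights of total mass 1 force [I] to be inhabited; the inhabitant is the
   default value of the enumeration. *)
have [i0 _|I0] := pickP (@predT I); last first.
  by move: w1; rewrite big_pred0 => [/esym/eqP|//]; rewrite oner_eq0.
pose e k := nth i0 (enum I) k.
pose m k := mscale (NngNum (w0 (e k))) (dirac (x (e k)) : measure X R).
pose Q := msum m #|I|.
have intQ (g : X -> \bar R) :
    measurable_fun [set: X] g -> (forall y, 0 <= g y)%E ->
    (\int[Q]_y g y = \sum_i (w i)%:E * g (x i))%E.
  move=> mg g0; rewrite ge0_integral_measure_sum//.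
  rewrite -[RHS]big_enum (big_nth i0) big_mkord -cardE.
  apply: eq_bigr => k _; rewrite ge0_integral_mscale// integral_dirac//=.
  by rewrite diracT mul1e.
have Q1 : Q setT = 1%E.
  rewrite -[LHS]mul1e -integral_cst// intQ//.
  by under eq_bigr do rewrite /= mule1; rewrite sumEFin w1.
pose P : probability X R := HB.pack (msum m #|I|)
  (Measure_isProbability.Build _ _ _ (msum m #|I|) Q1).
by exists P.
Qed.

(** * Independent coin tosses *)

Section coins.
Variables (T : nat) (p : rat).

Definition coin_weight (c : bool) : rat := if c then p else 1 - p.

Definition toss_weight (f : {ffun 'I_T -> bool}) : rat :=
  \prod_i coin_weight (f i).

Definition other_weight (t : 'I_T) (f : {ffun 'I_T -> bool}) : rat :=
  \prod_(i | i != t) coin_weight (f i).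

Definition flip (t : 'I_T) (f : {ffun 'I_T -> bool}) : {ffun 'I_T -> bool} :=
  [ffun i => f i (+) (i == t)].

Lemma flipK t : involutive (flip t).
Proof. by move=> f; apply/ffunP => i; rewrite !ffunE addbK. Qed.

Lemma toss_weight_sum : \sum_f toss_weight f = 1.
Proof.
rewrite -(bigA_distr_bigA (fun _ => coin_weight)) big1// => i _.
by rewrite big_bool /=; ring.
Qed.

(** Fubini for one coin: by independence, the expectation of [G] averages, over
the other coins, the expectation of [G] with respect to coin [t] alone.  The
tosses with [f t] true index the outcomes of the other coins. *)
Lemma toss_sum_split t (G : {ffun 'I_T -> bool} -> rat) :
  \sum_f toss_weight f * G f =
  \sum_(f : {ffun 'I_T -> bool} | f t)
     other_weight t f * (p * G f + (1 - p) * G (flip t f)).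
Proof.
have tossE f : toss_weight f = coin_weight (f t) * other_weight t f.
  by rewrite /toss_weight (bigD1 t).
rewrite (bigID (fun f : {ffun 'I_T -> bool} => f t))/=.
rewrite [X in _ + X](reindex_inj (inv_inj (@flipK t)))/=.
rewrite [X in _ + X](eq_bigl (fun f : {ffun 'I_T -> bool} => f t)); last first.
  by move=> f; rewrite ffunE eqxx addbT negbK.
rewrite -big_split/=; apply: eq_bigr => f ft.
have -> : toss_weight (flip t f) = (1 - p) * other_weight t f.
  rewrite tossE ffunE eqxx ft/=; congr (_ * _).
  by apply: eq_bigr => i /negPf it; rewrite ffunE it addbF.
by rewrite tossE ft /coin_weight; ring.
Qed.

Hypothesis p01 : 0 <= p <= 1.

Lemma coin_weight_ge0 c : 0 <= coin_weight c.
Proof. by have /andP[p0 p1] := p01; case: c; rewrite /coin_weight; lra. Qed.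

Lemma toss_weight_ge0 f : 0 <= toss_weight f.
Proof. by apply: prodr_ge0 => i _; exact: coin_weight_ge0. Qed.

(** A bound on the conditional expectation given all coins but one bounds the
expectation: both sides are split along coin [t], the left one being the
expectation of the constant [v]. *)
Lemma toss_sum_ge t (G : {ffun 'I_T -> bool} -> rat) v :
  (forall f : {ffun 'I_T -> bool}, f t ->
     v <= p * G f + (1 - p) * G (flip t f)) ->
  v <= \sum_f toss_weight f * G f.
Proof.
move=> vG; rewrite -[v]mul1r -toss_weight_sum mulr_suml.
rewrite (toss_sum_split t (fun=> v)) (toss_sum_split t G).
apply: ler_sum => f ft; apply: ler_wpM2l; last by have := vG f ft; lra.
by apply: prodr_ge0 => i _; exact: coin_weight_ge0.
Qed.

Lemma toss_sum_eq t (G : {ffun 'I_T -> bool} -> rat) v :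
  (forall f : {ffun 'I_T -> bool}, f t ->
     p * G f + (1 - p) * G (flip t f) = v) ->
  \sum_f toss_weight f * G f = v.
Proof.
move=> vG; apply/le_anti/andP; split; last first.
  by apply: (@toss_sum_ge t) => f /vG ->.
rewrite -lerN2 -sumrN; under eq_bigr do rewrite -mulrN.
by apply: (@toss_sum_ge t) => f /vG <-; lra.
Qed.

End coins.

(** * Demand paths *)

(** The product sigma-algebra separates points of a countable set, so it is
discrete: a policy, and with it the cost, can be an arbitrary function of the
demands without any loss of measurability. *)
Lemma measurable_demand_sets (U : {posnum rat}) (T : nat)
  (A : set (T.-tuple (ratIcc U))) : measurable A.
Proof.
apply: countable_measurable; last exact: countableP.
move=> d; have -> : [set d] =
    \bigcap_(i in [set: 'I_T]) (@demand_at U T i @^-1` [set tnth d i]).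
  apply/seteqP; split => [_ -> //|d' dd']; apply: eq_from_tnth => i.
  exact: (dd' i I).
apply: fin_bigcap_measurable => [|i _]; first exact: finite_finset.
by rewrite -[_ @^-1` _]setTI; apply: measurable_tnth.
Qed.

Lemma measurable_path_fun (R : realType) (U : {posnum rat}) (T : nat)
    (g : T.-tuple (ratIcc U) -> \bar R) :
  measurable_fun [set: T.-tuple (ratIcc U)] g.
Proof. by move=> _ Y _; exact: measurable_demand_sets. Qed.

Lemma expectation_demand (R : realType) (U : {posnum rat}) (T : nat)
    (Q : probability (T.-tuple (ratIcc U)) R) (t : 'I_T) :
  ('E_(distribution Q (@demand_at U T t))[fun x : ratIcc U => ratr (val x)] =
   \int[Q]_d (ratr (val (tnth d t)))%:E)%E.
Proof.
rewrite unlock ge0_integral_distribution//.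
by move=> x; rewrite lee_fin ler0q; case/andP: (valP x).
Qed.

(** * The inventory problem *)

Section inventory.
Variables (U b : {posnum rat}) (mu : rat).

Definition one_period_value : rat :=
  if mu <= U%:num / (b%:num + 1) then b%:num * mu else U%:num - mu.

Lemma Opt_INDE T : Opt_IND T mu U b%:num = T%:R * one_period_value.
Proof. by rewrite /Opt_IND /one_period_value; case: ifP => _; rewrite ?mulrA. Qed.

Lemma cost_ge0 x d : 0 <= cost b%:num x d.
Proof. by rewrite addr_ge0// ?mulr_ge0// le_max lexx orbT. Qed.

(** Against the two-point demand of mean [mu], the expected cost is affine in
the stock [x], so its minimum over [[0, U]] is attained at an endpoint. *)
Lemma two_point_cost x : 0 <= x <= U%:num ->
  one_period_value <= mu / U%:num * cost b%:num x U%:num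
                      + (1 - mu / U%:num) * cost b%:num x 0.
Proof.
move=> /andP[x0 xU].
have U0 : 0 < U%:num by []. have b0 : 0 < b%:num by [].
rewrite /cost sub0r subr0 (max_idPl _ : Num.max (U%:num - x) 0 = _) ?subr_ge0//.
rewrite (max_idPr _ : Num.max (x - U%:num) 0 = 0) ?subr_le0//.
rewrite (max_idPr _ : Num.max (- x) 0 = 0) ?oppr_le0//.
rewrite (max_idPl _ : Num.max x 0 = x)//.
have -> : mu / U%:num * (b%:num * (U%:num - x) + 0)
    + (1 - mu / U%:num) * (b%:num * 0 + x)
    = b%:num * mu + x / U%:num * (U%:num - (b%:num + 1) * mu).
  by field; rewrite gt_eqF.
have xU0 : 0 <= x / U%:num by rewrite divr_ge0// ltW.
have xU1 : x / U%:num <= 1 by rewrite ler_pdivrMr// mul1r.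
rewrite /one_period_value ler_pdivlMr; last by lra.
by case: ifPn; rewrite -?ltNge => h; nra.
Qed.

Variables (R : realType) (T : nat).

(** * Lower bound: independent extreme demands *)

Section lower_bound.
Hypothesis hmu : 0 <= mu <= U%:num.

Lemma extreme_demand_subproof (c : bool) :
  0 <= (if c then U%:num else 0) <= U%:num.
Proof. by case: c; rewrite lexx ltW. Qed.

Definition extreme_demand (c : bool) : ratIcc U :=
  exist _ (if c then U%:num else 0) (extreme_demand_subproof c).

Definition extreme_path (f : {ffun 'I_T -> bool}) : T.-tuple (ratIcc U) :=
  [tuple extreme_demand (f t) | t < T].

Lemma top_prob01 : 0 <= mu / U%:num <= 1.
Proof.
case/andP: hmu => mu0 muU.
by rewrite divr_ge0 ?ler_pdivrMr ?mul1r// ltW.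
Qed.

Lemma history_flip (t : 'I_T) f :
  history (ltnW (ltn_ord t)) (extreme_path (flip t f)) =
  history (ltnW (ltn_ord t)) (extreme_path f).
Proof.
apply: eq_from_tnth => i; rewrite !tnth_mktuple ffunE.
rewrite (_ : (_ == t) = false) ?addbF//.
by apply/negbTE; rewrite -val_eqE/= ltn_eqF.
Qed.

(** The law of independent demands that are [U] with probability [mu / U] and
[0] otherwise, described through the expectations it gives. *)
Lemma extreme_measure :
  exists2 Q : probability (T.-tuple (ratIcc U)) R, GEN mu Q &
  forall g : T.-tuple (ratIcc U) -> rat, (forall d, 0 <= g d) ->
    (\int[Q]_d (ratr (g d))%:E =
     (ratr (\sum_f toss_weight (mu / U%:num) f * g (extreme_path f)))%:E)%E.
Proof.
have w0 (f : {ffun 'I_T -> bool}) :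
    0 <= ratr (toss_weight (mu / U%:num) f) :> R.
  by rewrite ler0q toss_weight_ge0// top_prob01.
have w1 : \sum_(f : {ffun 'I_T -> bool})
    ratr (toss_weight (mu / U%:num) f) = 1 :> R.
  by rewrite -rmorph_sum toss_weight_sum rmorph1.
have [Q intQ] := finite_mixture extreme_path w0 w1.
have intQr (g : T.-tuple (ratIcc U) -> rat) : (forall d, 0 <= g d) ->
    (\int[Q]_d (ratr (g d))%:E =
     (ratr (\sum_f toss_weight (mu / U%:num) f * g (extreme_path f)))%:E)%E.
  move=> g0; rewrite intQ.
  - rewrite rmorph_sum -sumEFin; apply: eq_bigr => f _.
    by rewrite rmorphM EFinM.
  - exact: measurable_path_fun.
  - by move=> d; rewrite lee_fin ler0q.
exists Q => // t; rewrite /mean_measures/= expectation_demand.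
rewrite (intQr (fun d => val (tnth d t))); last first.
  by move=> d; case/andP: (valP (tnth d t)).
congr (ratr _)%:E; apply: (toss_sum_eq top_prob01 (t := t)) => f ft.
by rewrite !tnth_mktuple ffunE eqxx ft/= mulr0 addr0 divfK.
Qed.

Lemma period_cost_extreme (x : policy U T) t :
  (forall d, 0 <= x t d <= U%:num) ->
  one_period_value <=
  \sum_f toss_weight (mu / U%:num) f * period_cost b%:num x t (extreme_path f).
Proof.
move=> x0U; apply: (toss_sum_ge top_prob01 (t := t)) => f ft.
rewrite /period_cost history_flip !tnth_mktuple ffunE eqxx ft/=.
exact: two_point_cost.
Qed.

Lemma sup_cost_ge (x : policy U T) : @Policies U T 0 x ->
  ((ratr (T%:R * one_period_value))%:E <=
   ereal_sup [set 'E_Q[fun d => ratr (\sum_(t < T) period_cost b%:num x t d)%R]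
             | Q in @GEN R U T mu])%E.
Proof.
move=> [_ x0U]; have [Q Qmu intQ] := extreme_measure.
apply: le_trans (ereal_sup_ubound _); last by exists Q.
rewrite unlock intQ; last by move=> d; apply: sumr_ge0 => t _; exact: cost_ge0.
rewrite lee_fin ler_rat.
under eq_bigr do rewrite mulr_sumr.
rewrite exchange_big/= mulr_natl -[X in _ *+ X]card_ord -sumr_const.
by apply: ler_sum => t _; apply: period_cost_extreme => d; exact: x0U.
Qed.

End lower_bound.

(** * Upper bound: constant policies *)

Lemma GEN_mean (Q : probability (T.-tuple (ratIcc U)) R) : GEN mu Q ->
  forall t, (\int[Q]_d (ratr (val (tnth d t)))%:E = (ratr mu)%:E)%E.
Proof. by move=> Qmu t; rewrite -expectation_demand; exact: Qmu. Qed.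

Lemma GEN_mean_affine (Q : probability (T.-tuple (ratIcc U)) R) t (a c : rat) :
  GEN mu Q ->
  (\int[Q]_d (ratr (a + c * val (tnth d t)))%:E = (ratr (a + c * mu))%:E)%E.
Proof.
move=> Qmu.
(* A nonnegative function of finite expectation is integrable. *)
have intd : Q.-integrable setT (fun d => (ratr (val (tnth d t)))%:E).
  apply/integrableP; split; first exact: measurable_path_fun.
  under eq_integral => d _.
    rewrite gee0_abs; last by rewrite lee_fin ler0q; case/andP: (valP (tnth d t)).
    over.
  by rewrite GEN_mean// ltry.
have splitE (y : rat) :
    (ratr (a + c * y))%:E = ((ratr a)%:E + (ratr c)%:E * (ratr y)%:E)%E :> \bar R.
  by rewrite rmorphD rmorphM.
under eq_integral do rewrite splitE.
have inta : Q.-integrable setT (fun=> (ratr a)%:E).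
  exact: finite_measure_integrable_cst.
rewrite integralD//; last exact: integrableZl.
rewrite integralZl// GEN_mean// splitE; congr (_ + _)%E.
by rewrite (integral_cst Q measurableT) [X in (_ * X)%E]probability_setT mule1.
Qed.

(** An affine cost only sees the means of the marginals, which all the measures
in competition share, whatever the dependence between periods. *)
Lemma sup_cost_le (x : policy U T) (a c : rat) :
  (forall t d, period_cost b%:num x t d = a + c * val (tnth d t)) ->
  (ereal_sup [set 'E_Q[fun d => ratr (\sum_(t < T) period_cost b%:num x t d)%R]
             | Q in @GEN R U T mu] <= (ratr (T%:R * (a + c * mu)))%:E)%E.
Proof.
move=> xE; apply: ge_ereal_sup => _ [Q Qmu <-]; rewrite unlock.
under eq_integral do rewrite rmorph_sum -sumEFin.
rewrite ge0_integral_sum//.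
- under eq_bigr => t _.
    under eq_integral do rewrite xE.
    rewrite GEN_mean_affine//; over.
  by rewrite sumEFin sumr_const card_ord -rmorphMn mulr_natl.
- by move=> t; exact: measurable_path_fun.
- by move=> t d _; rewrite lee_fin ler0q; exact: cost_ge0.
Qed.

Definition constant_policy (y : rat) : policy U T := fun _ _ => y.

Lemma constant_policyP y :
  0 <= y <= U%:num -> @Policies U T 0 (constant_policy y).
Proof.
move=> yU; split; last by [].
split=> [t d _|s t st d _]; first by case/andP: yU.
by rewrite /constant_policy gerBl; case/andP: (valP (tnth d (Ordinal st))).
Qed.

Lemma optimal_policy :
  exists2 x : policy U T, @Policies U T 0 x &
  (ereal_sup [set 'E_Q[fun d => ratr (\sum_(t < T) period_cost b%:num x t d)%R]
             | Q in @GEN R U T mu] <= (ratr (T%:R * one_period_value))%:E)%E.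
Proof.
have dU t (d : T.-tuple (ratIcc U)) := valP (tnth d t).
rewrite /one_period_value; case: ifP => _.
- exists (constant_policy 0); first by apply: constant_policyP; rewrite lexx ltW.
  rewrite -[b%:num * mu]add0r; apply: sup_cost_le => t d.
  have /andP[d0 _] := dU t d.
  by rewrite /period_cost /cost subr0 sub0r max_l// max_r ?oppr_le0// addr0 add0r.
- exists (constant_policy U%:num).
    by apply: constant_policyP; rewrite lexx ltW.
  rewrite -[mu in _ - mu]mul1r -mulNr; apply: sup_cost_le => t d.
  have /andP[_ d1] := dU t d.
  rewrite /period_cost /cost max_r ?subr_le0// mulr0 add0r max_l ?subr_ge0//.
  by rewrite mulN1r.
Qed.

End inventory.

Theorem theorem5 (R : realType) (U b : {posnum rat}) (T : nat) (mu : rat)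
  (hT : (1 <= T)%N) (hmu : 0 <= mu <= U%:num) :
  Opt_GEN R T mu U b%:num = (ratr (Opt_IND T mu U b%:num))%:E.
Proof.
rewrite Opt_INDE; apply/le_anti/andP; split.
- have [x xP xle] := optimal_policy U b mu R T.
  by apply: ge_ereal_inf; eexists; first by exists x.
- by apply: le_ereal_inf_tmp => _ [x xP <-]; exact: sup_cost_ge.
Qed.
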